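(* Let $\mathcal{G}$ be a generalised quadrangle of order $(s,s^2)$ and let $\infty$ be a set of points of $\mathcal{G}$ such that $\mathcal{G}\setminus\infty$ is a partial quadrangle. Let $\mathcal{I}$ be an intriguing set of $\mathcal{G}$ with parameters $(h_1,h_2)$ such that $\mathcal{I}\setminus\infty$ is a nonempty proper subset of the point set of $\mathcal{G}\setminus\infty$. Then $\mathcal{I}\setminus\infty$ is an intriguing set of the partial quadrangle $\mathcal{G}\setminus\infty$ if and only if $\mathcal{I}$ is intriguing at infinity with respect to $\infty$.
   Context: A generalised quadrangle of order $(s,t)$ is a point-line incidence structure in which two distinct points are on at most one line, every line has $s+1$ points, every point is on $t+1$ lines, and for every point $P$ not on a line $\ell$ there is exactly one point of $\ell$ collinear with $P$; here $s\ge 2$. A partial quadrangle $\mathsf{PQ}(s,t,\mu)$ is a point-line incidence structure in which two distinct points are on at most one line, every line has $s+1$ points, every point is on $t+1$ lines, for every point $P$ not on a line $\ell$ there is at most one point of $\ell$ collinear with $P$, and any two non-collinear points have exactly $\mu$ points collinear with both. $\mathcal{G}\setminus\infty$ denotes the geometry whose points are the points of $\mathcal{G}$ not in $\infty$ and whose lines are the lines of $\mathcal{G}$ not contained in $\infty$, with inherited incidence; two points of it are collinear exactly when they are collinear in $\mathcal{G}$. $P^\perp$ is the set of all points (of $\mathcal{G}$) collinear with $P$, including $P$ itself, and $P^\sim = P^\perp\setminus\{P\}$. A nonempty proper subset $\mathcal{I}$ of the points of a generalised or partial quadrangle is an intriguing set with parameters (intersection numbers) $(h_1,h_2)$ if the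 number of points of $\mathcal{I}$ that are collinear with and distinct from a point $P$ is $h_1$ whenever $P\in\mathcal{I}$ and $h_2$ whenever $P\notin\mathcal{I}$. A set of points $\mathcal{I}$ of $\mathcal{G}$ is intriguing at infinity (with respect to $\infty$) if there are two constants $a_1,a_2$ such that $|y^\perp\cap\mathcal{I}\cap\infty|$ equals $a_1$ for every $y\in\mathcal{I}\setminus\infty$ and equals $a_2$ for every point $y\notin\mathcal{I}\cup\infty$. *)

(* Defs.v *)
From mathcomp Require Import all_boot.

Set Implicit Arguments.
Unset Strict Implicit.
Unset Printing Implicit Defensive.

(* Lines are abstract objects rather than sets of points.  Finiteness is no
   restriction here: a generalised quadrangle of finite order has finitely
   many points and lines. *)
Record geometry := Geometry {
  point : finType;
  line : finType;
  inc : point -> line -> bool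
}.

Section Geometry.

Variable G : geometry.
Implicit Types (P Q : point G) (l : line G) (A : {set point G}).

Definition points_on l : {set point G} := [set P | inc P l].

Definition lines_on P : {set line G} := [set l | inc P l].

Definition collinear P Q : bool := [exists l, inc P l && inc Q l].

Definition perp P : {set point G} := P |: [set Q | collinear P Q].

Definition perp_star P : {set point G} := perp P :\ P.

Definition partial_linear : Prop :=
  forall P Q, P != Q -> #|lines_on P :&: lines_on Q| <= 1.

Record is_GQ (s t : nat) : Prop := IsGQ {
  GQ_partial_linear : partial_linear;
  GQ_line : forall l, #|points_on l| = s.+1;
  GQ_point : forall P, #|lines_on P| = t.+1;
  GQ_proj : forall P l, ~~ inc P l ->
    #|[set Q in points_on l | collinear P Q]| = 1
}.

Record is_PQ (s t mu : nat) : Prop := IsPQ {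
  PQ_partial_linear : partial_linear;
  PQ_line : forall l, #|points_on l| = s.+1;
  PQ_point : forall P, #|lines_on P| = t.+1;
  PQ_proj : forall P l, ~~ inc P l ->
    #|[set Q in points_on l | collinear P Q]| <= 1;
  PQ_mu : forall P Q, P != Q -> ~~ collinear P Q ->
    #|[set R | collinear R P && collinear R Q]| = mu
}.

Definition partial_quadrangle : Prop := exists s t mu, is_PQ s t mu.

Definition nonempty_proper A : Prop := A != set0 /\ A \proper [set: point G].

Record intriguing (h1 h2 : nat) A : Prop := Intriguing {
  intriguing_np : nonempty_proper A;
  intriguing_in : forall P, P \in A -> #|A :&: perp_star P| = h1;
  intriguing_out : forall P, P \notin A -> #|A :&: perp_star P| = h2
}.

Definition is_intriguing A : Prop := exists h1 h2, intriguing h1 h2 A.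

Definition intriguing_at_infinity (oo A : {set point G}) : Prop :=
  exists a1 a2 : nat,
    (forall y, y \in A :\: oo -> #|perp y :&: A :&: oo| = a1) /\
    (forall y, y \notin A :|: oo -> #|perp y :&: A :&: oo| = a2).

End Geometry.

Definition delete (G : geometry) (oo : {set point G}) : geometry :=
  @Geometry {P : point G | P \notin oo}
            {l : line G | ~~ (points_on l \subset oo)}
            (fun P l => inc (val P) (val l)).

(* [A :\: oo], regarded as a set of points of [delete oo]. *)
Definition delete_set (G : geometry) (oo A : {set point G}) :
    {set point (delete oo)} :=
  [set P : {P : point G | P \notin oo} | val P \in A].

(* Main.v *)
Require Import Defs.
From mathcomp Require Import all_boot.

Set Implicit Arguments.
Unset Strict Implicit.
Unset Printing Implicit Defensive.

(** Deleting [oo] does not change collinearity between the remaining points: a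
    line joining two of them carries a point outside [oo], so it survives.
    Hence, for a point [y] outside [oo], the points of [I] collinear with and
    distinct from [y] are of two kinds, those remaining in [delete oo] and
    those lying in [oo]. The two counts add up to the intersection number of
    [I] at [y] ([card_perp_star_delete]), which is [h1] or [h2] according to
    whether [y] lies in [I]. On each of the two classes of points the sum is
    therefore constant, so one count is constant if and only if the other is;
    the former is the intriguing property of [I :\: oo], the latter is the
    intriguing property at infinity. *)

Section Delete.

Variables (G : geometry) (oo : {set point G}).

Lemma collinear_delete (P Q : point (delete oo)) :
  collinear P Q = collinear (val P) (val Q).
Proof.
apply/existsP/existsP => [[l PQl] | [l /andP[Pl Ql]]]; first by exists (val l).
have l_ok : ~~ (points_on l \subset oo).
  by apply/subsetPn; exists (val P); [rewrite inE | exact: (valP P)].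
by exists (exist _ l l_ok); rewrite /= Pl.
Qed.

Lemma perp_star_delete (P Q : point (delete oo)) :
  (Q \in perp_star P) = (val Q \in perp_star (val P)).
Proof. by rewrite !inE collinear_delete (inj_eq val_inj). Qed.

Lemma delete_set_perp_star (I : {set point G}) (y : point (delete oo)) :
  [set val Q | Q in delete_set oo I :&: perp_star y] =
  (I :&: perp_star (val y)) :\: oo.
Proof.
apply/setP => Q; apply/imsetP/idP => [[R + ->] | ].
  rewrite in_setI perp_star_delete inE => /andP[RI Ry].
  by rewrite in_setD in_setI RI Ry (valP R).
rewrite in_setD in_setI => /and3P[Q_ok QI Qy].
exists (exist _ Q Q_ok) => //.
by rewrite in_setI perp_star_delete inE /= QI.
Qed.

(** Since [y] itself is outside [oo], [perp] and [perp_star] agree on [oo]; so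
    the second summand is the part of [I :&: perp_star (val y)] inside [oo],
    and the first is the part outside. *)
Lemma card_perp_star_delete (I : {set point G}) (y : point (delete oo)) :
  #|delete_set oo I :&: perp_star y| + #|perp (val y) :&: I :&: oo| =
  #|I :&: perp_star (val y)|.
Proof.
rewrite -(card_imset _ val_inj) delete_set_perp_star.
rewrite -(cardsID oo (I :&: perp_star (val y))) addnC; congr (_ + _).
apply: eq_card => Q; rewrite !in_setI in_setD1.
have [-> | _] := eqVneq Q (val y); last by rewrite andTb [(Q \in I) && _]andbC.
by rewrite (negbTE (valP y)) !andbF.
Qed.

End Delete.

Theorem theorem4p1 (s : nat) (G : geometry) (oo I : {set point G})
    (h1 h2 : nat) :
  2 <= s ->
  is_GQ G s (s ^ 2) ->
  partial_quadrangle (delete oo) ->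
  intriguing h1 h2 I ->
  nonempty_proper (delete_set oo I) ->
  is_intriguing (delete_set oo I) <-> intriguing_at_infinity oo I.
Proof.
move=> _ _ _ [_ I_in I_out] I'_np.
split=> [[k1 [k2 [_ k_in k_out]]] | [a1 [a2 [a_in a_out]]]].
- exists (h1 - k1), (h2 - k2); split=> y.
  + rewrite in_setD => /andP[y_ok yI].
    have := card_perp_star_delete I (exist _ y y_ok : point (delete oo)).
    by rewrite k_in ?inE //= I_in // => <-; rewrite addKn.
  + rewrite in_setU negb_or => /andP[yI y_ok].
    have := card_perp_star_delete I (exist _ y y_ok : point (delete oo)).
    by rewrite k_out ?inE //= I_out // => <-; rewrite addKn.
- exists (h1 - a1), (h2 - a2); split=> // y; rewrite inE => yI.
  + have := card_perp_star_delete I y.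
    by rewrite a_in ?in_setD ?yI ?(valP y) // I_in // => <-; rewrite addnK.
  + have := card_perp_star_delete I y.
    rewrite a_out ?in_setU ?negb_or ?yI ?(valP y) // I_out // => <-.
    by rewrite addnK.
Qed.
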